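(* For any graphs $G$ and $H$, $\ell_G\, \ell_H \leq z_G\, z_H \leq Z(G \Box H)$. Moreover, if $z_G = Z(G)$ and $z_H = Z(H)$, then $Z(G)\,Z(H) \leq Z(G \Box H)$.
   Context: All graphs are simple and finite, with nonempty vertex set. Let $G$ be a graph and $S\subseteq V(G)$. Zero forcing: initially exactly the vertices of $S$ are observed; then the propagation step is applied repeatedly until no further vertex can be observed: every vertex which is the only unobserved neighbor of some observed vertex becomes observed. $S$ is a zero forcing set of $G$ (one says $S$ zero forces $G$) if every vertex of $G$ is eventually observed. The zero forcing number $Z(G)$ is the minimum cardinality of a zero forcing set of $G$. Power domination: first, in a single initialization step, all vertices in $S$ and all neighbors of vertices in $S$ are observed; then the propagation step above is applied repeatedly. $S$ power dominates $G$ if every vertex of $G$ is eventually observed. A partition $\Pi = \Pi_1 \cup \cdots \cup \Pi_k$ of $V(G)$ with $k\ge 2$ is a failed power dominating partition (respectively, a failed zero forcing partition) of $G$ if for each $i\in\{1,\dots,k\}$, the set $V(G)-\Pi_i$ does not power dominate (respectively, does not zero force) $G$. If a failed power dominating partition exists, $\ell_G$ is the maximum number of parts in one; otherwise $\ell_G=1$. If a failed zero forcing partition exists, $z_G$ is the maximum number of parts in one; otherwise $z_G=1$. The Cartesian product $G\Box H$ has vertex set $\{(g,h) : g\in V(G), h\in V(H)\}$; two vertices $(g_1,h_1)$ and $(g_2,h_2)$ are adjacent if either $g_1=g_2$ and $h_1h_2\in E(H)$, or $h_1=h_2$ and $g_1g_2\in E(G)$. *)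

(* Defs.v *)
From mathcomp Require Import all_boot.

Set Implicit Arguments.
Unset Strict Implicit.
Unset Printing Implicit Defensive.

Record sgraph := SGraph {
  vertex :> finType;
  adj : rel vertex;
  adj_sym : symmetric adj;
  adj_irrefl : irreflexive adj;
  vertex_gt0 : 0 < #|vertex| }.

Section Forcing.
Variable G : sgraph.
Implicit Types (S T : {set G}) (P : {set {set G}}).

(* One round of propagation: all the forces available from T are performed
   simultaneously. *)
Definition propagate T : {set G} :=
  T :|: [set w | [exists v in T,
                   [set x | adj v x && (x \notin T)] == [set w]]].

(* Every round before stabilization observes a new vertex, so #|G| rounds
   suffice; see propagate_observed. *)
Definition observed T : {set G} := iter #|G| propagate T.

Definition zero_forcing S : bool := observed S == [set: G].

Definition closed_nbhd S : {set G} :=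
  S :|: [set v | [exists u in S, adj u v]].

Definition power_dominating S : bool := observed (closed_nbhd S) == [set: G].

(* [set: G] is itself zero forcing, so the arg min is a genuine minimizer; see
   zero_forcingT. *)
Definition zero_forcing_number : nat :=
  #|[arg min_(S < [set: G] | zero_forcing S) #|S| ]|.

(* "partition" requires nonempty blocks. An empty block could not occur anyway,
   as its complement [set: G] zero forces and power dominates G. *)
Definition failed_pd_partition P : bool :=
  [&& partition P [set: G], 2 <= #|P|
    & [forall B in P, ~~ power_dominating (~: B)]].

Definition failed_zf_partition P : bool :=
  [&& partition P [set: G], 2 <= #|P|
    & [forall B in P, ~~ zero_forcing (~: B)]].

Definition failed_pd_number : nat :=
  if [exists P, failed_pd_partition P]
  then \max_(P | failed_pd_partition P) #|P| else 1.

Definition failed_zf_number : nat :=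
  if [exists P, failed_zf_partition P]
  then \max_(P | failed_zf_partition P) #|P| else 1.

Lemma propagate_sub T : T \subset propagate T.
Proof. exact: subsetUl. Qed.

Lemma propagate_observed T : propagate (observed T) = observed T.
Proof.
have H n : propagate (iter n propagate T) = iter n propagate T
           \/ n <= #|iter n propagate T|.
  elim: n => [|n [IH|IH]]; first by right.
    by left; rewrite iterS !IH.
  have [E|NE] := eqVneq (propagate (iter n propagate T)) (iter n propagate T).
    by left; rewrite iterS !E.
  right; rewrite iterS; apply: leq_ltn_trans IH _.
  by apply: proper_card; rewrite properEneq eq_sym NE propagate_sub.
have [//|le_card] := H #|G|.
have E : observed T = [set: G].
  by apply/eqP; rewrite eqEcard subsetT cardsT.
by rewrite E /propagate setTU.
Qed.

Lemma zero_forcingT : zero_forcing [set: G].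
Proof.
rewrite /zero_forcing /observed; elim: #|G| => [|n /eqP IH] //=.
by rewrite IH /propagate setTU.
Qed.

End Forcing.

Section CartesianProduct.
Variables G H : sgraph.

Definition cart_adj : rel (G * H) := fun p q =>
  (p.1 == q.1) && adj p.2 q.2 || (p.2 == q.2) && adj p.1 q.1.

Lemma cart_adj_sym : symmetric cart_adj.
Proof.
by move=> p q; rewrite /cart_adj adj_sym (adj_sym p.1) !(eq_sym (p.1))
  !(eq_sym (p.2)).
Qed.

Lemma cart_adj_irrefl : irreflexive cart_adj.
Proof. by move=> p; rewrite /cart_adj !adj_irrefl !andbF. Qed.

Lemma cart_gt0 : 0 < #|{: G * H}|.
Proof. by rewrite card_prod muln_gt0 !vertex_gt0. Qed.

Definition cart_prod : sgraph := SGraph cart_adj_sym cart_adj_irrefl cart_gt0.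

End CartesianProduct.

(* Main.v *)
Require Import Defs.
From mathcomp Require Import all_boot.

(** The theorem is a statement about forts. A fort is a nonempty set [F] of
vertices such that no vertex outside [F] has exactly one neighbor in [F]: once
everything but [F] is observed, propagation is stuck. Hence the zero forcing
sets are exactly the sets that meet every fort ([zero_forcingP]), and a failed
zero forcing partition is a partition into at least two blocks, each of which
contains a fort.
The whole vertex set is always a fort, so the one-block partition takes care
of the graphs that have no failed partition ([failed_zf_number_attained]).

If [F] is a fort of [G] and [F'] is a fort of [H], then their product is a fort
of the Cartesian product ([fort_setX]): the neighbors in the product set of a
vertex outside it all lie in a single copy of [G] or of [H], so that they are
counted by the fort condition in that factor. Two families of disjoint forts,
one in each factor, therefore give a product family of disjoint forts, and a
zero forcing set of the Cartesian product has a vertex in each of them.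

The comparison between the failed power domination and zero forcing numbers
holds because observing more vertices at the start never hurts
([observedS]), so that a zero forcing set is power dominating. *)

Set Implicit Arguments.
Unset Strict Implicit.
Unset Printing Implicit Defensive.

Section Forts.
Variable G : sgraph.
Implicit Types (S T F B : {set G}) (P : {set {set G}}).

Definition fort F : bool :=
  (F != set0) && [forall v, (v \notin F) ==> (#|[set x in F | adj v x]| != 1)].

Lemma fortT : fort [set: G].
Proof.
apply/andP; split; first by rewrite -card_gt0 cardsT vertex_gt0.
by apply/forallP=> v; rewrite inE.
Qed.

(** A force available from [T] is still available from a larger set unless its
target has already been observed there. *)
Lemma propagateS S T : S \subset T -> propagate S \subset propagate T.
Proof.
move=> sST; apply/subsetP=> w; rewrite !inE => /orP[/(subsetP sST)->//|].
case/existsP=> v /andP[vS /eqP Dw].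
case: (boolP (w \in T)) => //= wT; apply/existsP; exists v.
rewrite (subsetP sST) //=; apply/eqP/setP=> x; move/setP/(_ x): Dw; rewrite !inE.
have [->|_] := eqVneq x w; first by rewrite wT; case/andP=> ->.
by case: (adj v x) => //= /negbFE/(subsetP sST)->.
Qed.

Lemma observedS S T : S \subset T -> observed S \subset observed T.
Proof.
by move=> sST; rewrite /observed; elim: #|G| => //= n; apply: propagateS.
Qed.

Lemma sub_observed S : S \subset observed S.
Proof.
rewrite /observed; elim: #|G| => //= n IH.
exact: subset_trans IH (propagate_sub _).
Qed.

Lemma zero_forcing_power_dominating S : zero_forcing S -> power_dominating S.
Proof.
rewrite /zero_forcing /power_dominating -!subTset => /subset_trans; apply.
by apply: observedS; apply: subsetUl.
Qed.

Lemma fort_stalled F : fort F -> propagate (~: F) = ~: F.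
Proof.
case/andP=> _ /forallP fF; apply/eqP; rewrite eqEsubset propagate_sub andbT.
apply/subsetP=> w; rewrite !inE => /orP[//|/existsP[v /andP[vF /eqP Dw]]].
rewrite inE in vF; have:= fF v; rewrite vF /= => /negP[].
have <-: [set x | adj v x && (x \notin ~: F)] = [set x in F | adj v x].
  by apply/setP=> x; rewrite !inE negbK andbC.
by rewrite Dw cards1.
Qed.

Lemma stalled_fort T : propagate T = T -> T != [set: G] -> fort (~: T).
Proof.
move=> stT neT; apply/andP; split.
  by apply: contraNneq neT => T0; rewrite -(setCK T) T0 setC0.
apply/forallP=> v; apply/implyP; rewrite inE negbK => vT.
apply/cards1P=> -[w Dw].
have: w \in [set x in ~: T | adj v x] by rewrite Dw set11.
rewrite !inE => /andP[/negP[]].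
rewrite -stT !inE; apply/orP; right; apply/existsP; exists v; rewrite vT -Dw.
by apply/eqP/setP=> x; rewrite !inE andbC.
Qed.

(** The complement of a fort is stuck under propagation, and conversely the
vertices that a failing set never observes form a fort that it misses. *)
Lemma zero_forcingP S :
  reflect (forall F, fort F -> ~~ [disjoint S & F]) (zero_forcing S).
Proof.
apply: (iffP idP) => [zfS F fF | meetS].
  apply/negP; rewrite disjoints_subset => /observedS.
  have ->: observed (~: F) = ~: F.
    by rewrite /observed; elim: #|G| => //= n ->; apply: fort_stalled.
  rewrite (eqP zfS) subTset => /eqP FT.
  by have /andP[/eqP[]] := fF; rewrite -(setCK F) FT setCT.
apply: contraT => nzfS.
have /meetS/negP[] := stalled_fort (propagate_observed S) nzfS.
by rewrite disjoints_subset setCK sub_observed.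
Qed.

Lemma fort_in_failed_block B :
  ~~ zero_forcing (~: B) -> exists2 F, fort F & F \subset B.
Proof.
move=> nzf; exists (~: observed (~: B)).
  exact: stalled_fort (propagate_observed _) nzf.
by rewrite -setCS setCK sub_observed.
Qed.

(** The single block [[set: G]] plays the role of a failed partition when there
is none with two blocks: it is itself a fort. *)
Lemma failed_zf_number_attained :
  exists P, [/\ partition P [set: G], #|P| = failed_zf_number G
              & forall B, B \in P -> ~~ zero_forcing (~: B)].
Proof.
rewrite /failed_zf_number; case: ifPn => [/existsP[P0 fP0] | _].
  have [P /and3P[partP _ /forall_inP fP] ->] :=
    eq_bigmax_cond (fun P => #|P|) (introT card_gt0P (ex_intro _ P0 fP0)).
  by exists P; split.
exists [set [set: G]]; rewrite cards1; split=> // [|B /set1P->].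
  rewrite /partition /cover big_set1 eqxx trivIset1 inE eq_sym /=.
  by case/andP: fortT.
apply/zero_forcingP=> /(_ _ fortT)/negP[].
by rewrite setCT disjoints_subset sub0set.
Qed.

Lemma failed_zf_number_gt0 : 0 < failed_zf_number G.
Proof.
have [P [partP <- _]] := failed_zf_number_attained; apply/card_gt0P.
have /card_gt0P[x _] := vertex_gt0 G.
by exists (pblock P x); apply: pblock_mem; rewrite (cover_partition partP).
Qed.

Lemma failed_pd_partition_zf P :
  failed_pd_partition P -> failed_zf_partition P.
Proof.
case/and3P=> partP gt1 /forall_inP fP; apply/and3P; split=> //.
apply/forall_inP=> B /fP; apply: contra; exact: zero_forcing_power_dominating.
Qed.

Lemma failed_pd_number_leq_zf : failed_pd_number G <= failed_zf_number G.
Proof.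
rewrite {1}/failed_pd_number; case: ifP => _; last exact: failed_zf_number_gt0.
apply/bigmax_leqP=> P /failed_pd_partition_zf fP.
rewrite /failed_zf_number ifT; last by apply/existsP; exists P.
exact: (@leq_bigmax_cond _ (@failed_zf_partition G) (fun P => #|P|)) fP.
Qed.

End Forts.

Section Product.
Variables G H : sgraph.

(** A vertex outside the product has a coordinate outside its fort; its
neighbors in the product then agree with it in the other coordinate. *)
Lemma fort_setX (F : {set G}) (F' : {set H}) :
  fort F -> fort F' -> @fort (cart_prod G H) (setX F F').
Proof.
case/andP=> F0 /forallP fF /andP[F'0 /forallP fF']; apply/andP; split.
  have [/set0Pn[x xF] /set0Pn[y yF']] := (F0, F'0).
  by apply/set0Pn; exists (x, y); rewrite inE xF.
apply/forallP=> -[g h]; apply/implyP; rewrite inE /=.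
set N := [set _ in _ | _].
have DN x y : (x, y) \in N = [&& x \in F, y \in F' & cart_adj (g, h) (x, y)].
  by rewrite !inE andbA.
case: (boolP (g \in F)) (fF g) => /= [gF _ hF' | gF fg _].
  have <-: [set (g, y) | y in [set y in F' | adj h y]] = N.
    apply/setP=> -[x y]; rewrite DN /cart_adj /=; apply/imsetP/and3P.
      by case=> z; rewrite inE => /andP[zF' hz] [-> ->]; rewrite eqxx hz.
    case=> xF yF' /orP[/andP[/eqP-> hy] | /andP[/eqP hy _]].
      by exists y; rewrite // inE yF'.
    by rewrite hy yF' in hF'.
  by rewrite card_imset ?(implyP (fF' h)) // => y1 y2 [].
have [hF' | hF'] := boolP (h \in F').
  have <-: [set (x, h) | x in [set x in F | adj g x]] = N.
    apply/setP=> -[x y]; rewrite DN /cart_adj /=; apply/imsetP/and3P.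
      case=> z; rewrite inE => /andP[zF gz] [-> ->].
      by rewrite eqxx gz orbT.
    case=> xF yF' /orP[/andP[/eqP gx _] | /andP[/eqP-> gx]].
      by rewrite gx xF in gF.
    by exists x; rewrite // inE xF.
  by rewrite card_imset // => x1 x2 [].
suff ->: N = set0 by rewrite cards0.
apply/setP=> -[x y]; rewrite DN /cart_adj inE /=; apply/and3P=> -[xF yF'].
case/orP=> /andP[/eqP E _]; first by rewrite E xF in gF.
by rewrite E yF' in hF'.
Qed.

(** Sending a vertex of a zero forcing set [S] to the pair of blocks that hold
its coordinates hits every pair of blocks, since [S] meets the product of the
forts that these blocks contain. *)
Lemma failed_zf_number_mul_leq :
  failed_zf_number G * failed_zf_number H
    <= zero_forcing_number (cart_prod G H).
Proof.
rewrite /zero_forcing_number; case: arg_minnP => [|S zfS _].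
  exact: zero_forcingT.
have [P [partP <- fP]] := failed_zf_number_attained G.
have [Q [partQ <- fQ]] := failed_zf_number_attained H.
rewrite -cardsX.
apply: leq_trans (leq_imset_card (fun p => (pblock P p.1, pblock Q p.2)) S).
apply/subset_leq_card/subsetP=> -[B C]; rewrite inE => /andP[/= BP CQ].
have [F fF sFB] := fort_in_failed_block (fP B BP).
have [F' fF' sF'C] := fort_in_failed_block (fQ C CQ).
have /pred0Pn[[x y] /andP[/= xyS]] := zero_forcingP _ zfS _ (fort_setX fF fF').
rewrite inE /= => /andP[/(subsetP sFB) xB /(subsetP sF'C) yC].
apply/imsetP; exists (x, y) => //=.
have [/and3P[_ tP _] /and3P[_ tQ _]] := (partP, partQ).
by rewrite (def_pblock tP BP xB) (def_pblock tQ CQ yC).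
Qed.

End Product.

Theorem theorem6 (G H : sgraph) :
  (failed_pd_number G * failed_pd_number H
     <= failed_zf_number G * failed_zf_number H
     <= zero_forcing_number (cart_prod G H))
  /\ (failed_zf_number G = zero_forcing_number G ->
      failed_zf_number H = zero_forcing_number H ->
      zero_forcing_number G * zero_forcing_number H
        <= zero_forcing_number (cart_prod G H)).
Proof.
have le_zZ := failed_zf_number_mul_leq G H.
split; last by move=> <- <-.
by rewrite le_zZ andbT leq_mul // failed_pd_number_leq_zf.
Qed.
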